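(* Let $a_0,a_1,a_2,b_0,b_1,b_2\in\mathbb{C}^{\times}$ be constants with $\prod_{i=0}^{2}a_ib_i=-1$, and let $\mathcal{E}$ be the instanton-corrected mirror of the tropical Lagrangian multi-section $\mathbb{L}$, i.e. the rank $2$ holomorphic vector bundle on $\mathbb{P}^2$ obtained by gluing the trivial bundles $\mathcal{E}_k=\mathcal{O}_{U_k}^{\oplus 2}$ ($k=0,1,2$) by means of the transition functions $\tau'_{10},\tau'_{21},\tau'_{02}$ given in the context. Then $\mathcal{E}$ is isomorphic, as a holomorphic vector bundle, to the holomorphic tangent bundle $T_{\mathbb{P}^2}$ of $\mathbb{P}^2$.
   Context: Let $[\zeta_0:\zeta_1:\zeta_2]$ be homogeneous coordinates on the complex projective plane $\mathbb{P}^2$. For $k=0,1,2$ let $U_k=\{\zeta_k\neq 0\}\cong\mathbb{C}^2$, with coordinates $w_k^i:=\zeta_i/\zeta_k$ ($i\neq k$), and put $U_{ij}:=U_i\cap U_j$. On each $U_k$ take the trivial rank $2$ holomorphic bundle $\mathcal{E}_k$, the direct sum of two trivial line bundles $\mathcal{L}_k^{\pm}=\mathcal{O}_{U_k}$. (The two summands are indexed by the two maximal cones $\sigma_k^{\pm}$ of a two-sheeted branched cover $L\to\mathbb{R}^2$, which is the domain of the tropical Lagrangian multi-section $\mathbb{L}$. The cones $\sigma_k^{\pm}$ lie over the cone $\sigma_k$ of the fan of $\mathbb{P}^2$ corresponding to $U_k$. The frames are ordered as $\mathcal{E}_0=\mathcal{L}_0^-\oplus\mathcal{L}_0^+$, $\mathcal{E}_1=\mathcal{L}_1^+\oplus\mathcal{L}_1^-$,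 $\mathcal{E}_2=\mathcal{L}_2^-\oplus\mathcal{L}_2^+$.) For constants $a_i,b_i\in\mathbb{C}^{\times}$ with $\prod_{i=0}^2 a_ib_i=-1$, define $$\tau^{sf}_{10}=\begin{pmatrix}\frac{a_0}{(w_0^1)^2}&0\\0&\frac{b_0}{w_0^1}\end{pmatrix},\quad \tau^{sf}_{21}=\begin{pmatrix}\frac{b_1}{w_1^2}&0\\0&\frac{a_1}{(w_1^2)^2}\end{pmatrix},\quad \tau^{sf}_{02}=\begin{pmatrix}0&\frac{b_2}{w_2^0}\\\frac{a_2}{(w_2^0)^2}&0\end{pmatrix},$$ $$\Theta_{10}=\begin{pmatrix}1&0\\-a_0b_1a_2\frac{w_0^2}{w_0^1}&1\end{pmatrix},\quad \Theta_{21}=\begin{pmatrix}1&-a_0a_1b_2\frac{w_1^0}{w_1^2}\\0&1\end{pmatrix},\quad \Theta_{02}=\begin{pmatrix}1&0\\-b_0a_1a_2\frac{w_2^1}{w_2^0}&1\end{pmatrix},$$ and $\tau'_{ij}:=\tau^{sf}_{ij}\Theta_{ij}$ on $U_{ij}$ for $(i,j)=(1,0),(2,1),(0,2)$. The matrix $\tau'_{ij}$ sends fibre coordinates of $\mathcal{E}_j$ to fibre coordinates of $\mathcal{E}_i$, and $\tau'_{ji}:=(\tau'_{ij})^{-1}$. These satisfy the cocycle condition $\tau'_{02}\tau'_{21}\tau'_{10}=I$ on $U_0\cap U_1\cap U_2$, so they define a rank $2$ holomorphic vector bundle $\mathcal{E}$ on $\mathbb{P}^2$, called the instanton-corrected mirror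 of $\mathbb{L}$. *)

(* Defs.v *)
From mathcomp Require Import all_boot all_order all_algebra perm complex.
From mathcomp Require Import all_classical all_reals all_analysis.
From mathcomp Require Import ring.

Set Implicit Arguments.
Unset Strict Implicit.
Unset Printing Implicit Defensive.

Import Order.TTheory GRing.Theory Num.Theory numFieldNormedType.Exports.
Local Open Scope classical_set_scope.
Local Open Scope ring_scope.

(* The base field is an arbitrary [C : numFieldType]. For C = R[i] with
   R : realType, [differentiable] is complex (Frechet) differentiability, and a
   map that is complex differentiable on an open set is holomorphic there. *)

(* A holomorphic atlas of dimension n. [param k] is the inverse of [chart k] on
   the image of [chart k] and is irrelevant elsewhere. The charts determine the
   topology: see [open_in]. *)
Record holo_atlas (C : numFieldType) (n : nat) := HoloAtlas {
  atlas_point :> Type;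
  chart_ix : Type;
  chart_dom : chart_ix -> set atlas_point;
  chart : chart_ix -> atlas_point -> 'rV[C]_n;
  param : chart_ix -> 'rV[C]_n -> atlas_point;
  chart_cover : forall p, exists k, chart_dom k p;
  chartK : forall k p, chart_dom k p -> param k (chart k p) = p;
  chart_open : forall j k, open (chart j @` (chart_dom j `&` chart_dom k));
  chart_holo : forall j k z, (chart j @` (chart_dom j `&` chart_dom k)) z ->
    differentiable (chart k \o param j) z
}.
Arguments chart_dom {C n M} : rename.
Arguments chart {C n M} : rename.
Arguments param {C n M} : rename.

Section Bundles.
Variables (C : numFieldType) (n : nat) (M : holo_atlas C n).

Definition open_in (U : set M) :=
  forall k, open (chart k @` (chart_dom k `&` U)).

(* Only used for U open. *)
Definition holomorphic_on r s (U : set M) (f : M -> 'M[C]_(r, s)) :=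
  forall k z, (chart k @` (chart_dom k `&` U)) z ->
    differentiable (f \o param k) z.

(* A holomorphic vector bundle of rank r over M: local trivializations
   e |-> (bundle_proj e, fibre_coord i e) over an open cover, whose transition
   functions are linear in the fibres and holomorphic in the base. The vector
   space structure of the fibres and the complex structure of the total space
   are the ones transported by the trivializations. *)
Record holo_bundle (r : nat) := HoloBundle {
  total_space : Type;
  bundle_proj : total_space -> M;
  triv_ix : Type;
  triv_dom : triv_ix -> set M;
  fibre_coord : triv_ix -> total_space -> 'cV[C]_r;
  triv_open : forall i, open_in (triv_dom i);
  triv_cover : forall p, exists i, triv_dom i p;
  fibre_coord_bij : forall i p, triv_dom i p -> forall v : 'cV[C]_r,
    exists! e, bundle_proj e = p /\ fibre_coord i e = v;
  fibre_coord_trans : forall i j, exists g : M -> 'M[C]_r,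
    holomorphic_on (triv_dom i `&` triv_dom j) g /\
    forall e, (triv_dom i `&` triv_dom j) (bundle_proj e) ->
      fibre_coord i e = g (bundle_proj e) *m fibre_coord j e
}.

Definition bundle_morphism r s (E : holo_bundle r) (F : holo_bundle s)
    (phi : total_space E -> total_space F) :=
  (forall e, bundle_proj (phi e) = bundle_proj e) /\
  forall (i : triv_ix E) (j : triv_ix F), exists h : M -> 'M[C]_(s, r),
    holomorphic_on (triv_dom i `&` triv_dom j) h /\
    forall e, (triv_dom i `&` triv_dom j) (bundle_proj e) ->
      fibre_coord j (phi e) = h (bundle_proj e) *m fibre_coord i e.

Definition bundle_isomorphic r s (E : holo_bundle r) (F : holo_bundle s) :=
  exists (phi : total_space E -> total_space F)
         (psi : total_space F -> total_space E),
    [/\ bundle_morphism phi, bundle_morphism psi,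
        cancel phi psi & cancel psi phi].

(* Gluing data; [trans_fun i j] sends the j-th fibre coordinates to the i-th ones,
   and only its values on the overlap matter. *)
Record cocycle (r : nat) := Cocycle {
  cov_ix : Type;
  cov_dom : cov_ix -> set M;
  trans_fun : cov_ix -> cov_ix -> M -> 'M[C]_r;
  cov_open : forall i, open_in (cov_dom i);
  cov_cover : forall p, exists i, cov_dom i p;
  trans_holo : forall i j, holomorphic_on (cov_dom i `&` cov_dom j) (trans_fun i j);
  trans_id : forall i p, cov_dom i p -> trans_fun i i p = 1%:M;
  trans_mul : forall i j k p, cov_dom i p -> cov_dom j p -> cov_dom k p ->
    trans_fun i j p *m trans_fun j k p = trans_fun i k p
}.

(* A point of the glued space, i.e. an equivalence class in the disjoint union
   of the (cov_dom i) x C^r, encoded as its base point together with the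
   family of its representatives (v_i)_i, where v_i = g_ij v_j. *)
Record glued r (c : cocycle r) := Glued {
  glued_base : M;
  glued_coord : cov_ix c -> 'cV[C]_r;
  glued_out : forall i, ~ cov_dom i glued_base -> glued_coord i = 0;
  glued_compat : forall i j, cov_dom i glued_base -> cov_dom j glued_base ->
    glued_coord i = trans_fun i j glued_base *m glued_coord j
}.

Lemma glued_eq r (c : cocycle r) (e f : glued c) :
  glued_base e = glued_base f -> glued_coord e = glued_coord f -> e = f.
Proof.
case: e f => [p v v1 v2] [q w w1 w2] /= epq evw; subst q w.
by congr Glued; exact: Prop_irrelevance.
Qed.

Lemma glued_bij r (c : cocycle r) (i : cov_ix c) p : cov_dom i p ->
  forall v : 'cV[C]_r,
    exists! e : glued c, glued_base e = p /\ glued_coord e i = v.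
Proof.
move=> ip v.
pose w j := if pselect (cov_dom j p) then trans_fun j i p *m v else 0.
have w1 j : ~ cov_dom j p -> w j = 0 by rewrite /w; case: pselect.
have wE j : cov_dom j p -> w j = trans_fun j i p *m v by rewrite /w; case: pselect.
have w2 j k : cov_dom j p -> cov_dom k p -> w j = trans_fun j k p *m w k.
  by move=> jp kp; rewrite !wE// mulmxA trans_mul.
exists (Glued w1 w2); split=> /=.
  by split=> //; rewrite wE// trans_id// mul1mx.
case=> [q u u1 u2] /= [eqp euv]; subst q v.
apply: glued_eq => //=; apply/funext => j.
have [jp|njp] := pselect (cov_dom j p); first by rewrite wE// -u2.
by rewrite w1// u1.
Qed.

Lemma glued_trans r (c : cocycle r) (i j : cov_ix c) :
  exists g : M -> 'M[C]_r, holomorphic_on (cov_dom i `&` cov_dom j) g /\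
    forall e : glued c, (cov_dom i `&` cov_dom j) (glued_base e) ->
      glued_coord e i = g (glued_base e) *m glued_coord e j.
Proof.
exists (trans_fun i j); split; first exact: trans_holo.
by move=> e [ie je]; exact: glued_compat.
Qed.

Definition glue_bundle r (c : cocycle r) : holo_bundle r :=
  HoloBundle (@cov_open r c) (@cov_cover r c) (@glued_bij r c)
    (@glued_trans r c).

(* The transition functions of the holomorphic tangent bundle in the coordinate
   frames: the Jacobian matrices of the changes of coordinates. The transpose is
   there because [jacobian] acts on row vectors. *)
Definition tangent_trans (i j : chart_ix M) (p : M) : 'M[C]_n :=
  (jacobian (chart i \o param j) (chart j p))^T.

End Bundles.

Section Differentials.
Variables (C : numFieldType) (V W : normedModType C).

Lemma near_eq_diff (f g : V -> W) x : (\forall y \near x, f y = g y) ->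
  differentiable f x -> differentiable g x /\ 'd g x = 'd f x :> (V -> W).
Proof.
move=> fg df.
have fgx : f x = g x by exact: (nbhs_singleton fg).
have gE : g \o shift x = cst (g x) + 'd f x +o_ 0 id.
  have /eqaddoP fE := diff_locally df.
  apply/eqaddoP => e /fE {}fE.
  have {}fg : \forall h \near (0 : V), f (shift x h) = g (shift x h).
    by move: fg; rewrite (near_shift 0 x) /= subr0.
  by apply: filterS2 fE fg => h /= + fgh; rewrite !fctE /= fgh fgx.
have dgE : 'd g x = 'd f x :> (V -> W).
  exact: (diff_unique (diff_continuous df) gE).
split=> //; apply/diff_locallyP; rewrite dgE; split=> //.
exact: diff_continuous.
Qed.

Lemma near_eq_differentiable (f g : V -> W) x :
  (\forall y \near x, f y = g y) -> differentiable f x -> differentiable g x.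
Proof. by move=> fg /(near_eq_diff fg)[]. Qed.

End Differentials.

Section MatrixDifferentials.
Variables (C : numFieldType) (V : normedModType C).

Lemma differentiable_div (f g : V -> C) x :
  differentiable f x -> differentiable g x -> g x != 0 ->
  differentiable (fun y => f y / g y) x.
Proof. by move=> df dg gx; apply: differentiableM => //; exact: differentiableV. Qed.

Lemma differentiable_mx r s (f : V -> 'M[C]_(r, s)) x :
  (forall i j, differentiable (fun y => f y i j) x) -> differentiable f x.
Proof.
move=> df.
have -> : f = \sum_(ij : 'I_r * 'I_s)
    (fun y => f y ij.1 ij.2 *: delta_mx ij.1 ij.2).
  apply/funext => y; rewrite fct_sumE {1}[f y]matrix_sum_delta.
  by rewrite pair_big.
elim/big_ind : _ => [|g h dg dh|ij _]; first exact: differentiable_cst.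
  exact: differentiableD.
exact: differentiableZl.
Qed.

Lemma differentiable_entry r s (f : V -> 'M[C]_(r, s)) x i j :
  differentiable f x -> differentiable (fun y => f y i j) x.
Proof.
move=> df.
exact: (differentiable_comp df (differentiable_coord (f x) i j)).
Qed.

Lemma diff_entry r s (f : V -> 'M[C]_(r, s)) x i j v : differentiable f x ->
  'd (fun y => f y i j : C) x v = 'd f x v i j.
Proof.
move=> df.
have @g : {linear 'M[C]_(r, s) -> C}.
  by exists (fun N : 'M[C]_(r, s) => N i j); do 2![eexists]; do ?[constructor];
     rewrite ?mxE// => ? *; rewrite ?mxE//; move=> ?; rewrite !mxE.
have gc : continuous g by exact: coord_continuous.
have := diff_comp df (linear_differentiable (f x) gc).
rewrite (diff_lin (f x) gc) => dE.
exact: (congr1 (fun h => h v) dE).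
Qed.

Lemma diff_div (f g : V -> C) x v :
  differentiable f x -> differentiable g x -> g x != 0 ->
  'd (fun y => f y / g y) x v =
    ('d f x v * g x - f x * 'd g x v) / g x ^+ 2.
Proof.
move=> df dg gx; have dgV := differentiableV dg gx.
have dE := diffM df dgV.
apply: etrans (congr1 (fun h => h v) dE) _.
rewrite (diffV dg gx) /= /GRing.scale /=.
change ((f x * (- (g x) ^- 2 * 'd g x v) + (g x)^-1 * 'd f x v) =
  ('d f x v * g x - f x * 'd g x v) / g x ^+ 2).
by field.
Qed.

Lemma differentiable_mulmx r s t (f : V -> 'M[C]_(r, s)) (g : V -> 'M[C]_(s, t)) x :
  differentiable f x -> differentiable g x ->
  differentiable (fun y => f y *m g y) x.
Proof.
move=> df dg; apply: differentiable_mx => i j.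
have -> : (fun y => (f y *m g y) i j) =
    \sum_k (fun y => f y i k) * (fun y => g y k j).
  by apply/funext => y; rewrite fct_sumE mxE.
elim/big_ind : _ => [|u v du dv|k _]; first exact: differentiable_cst.
  exact: differentiableD.
by apply: differentiableM; exact: differentiable_entry.
Qed.

Lemma differentiable_det r (f : V -> 'M[C]_r) x :
  (forall i j, differentiable (fun y => f y i j) x) ->
  differentiable (fun y => \det (f y) : C) x.
Proof.
move=> df.
have -> : (fun y => \det (f y)) = \sum_(s : {perm 'I_r})
    (cst ((-1) ^+ s) * \prod_i (fun y => f y i (s i))).
  apply/funext => y; rewrite fct_sumE; apply: eq_bigr => s _ /=.
  by congr (_ * _); rewrite fct_prodE.
elim/big_ind : _ => [|u v du dv|s _]; first exact: differentiable_cst.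
  exact: differentiableD.
apply: differentiableM; first exact: differentiable_cst.
elim/big_ind : _ => [|u v du dv|i _]; first exact: differentiable_cst.
  exact: differentiableM.
exact: df.
Qed.

Lemma nbhs_neq0 (c : C) : c != 0 -> nbhs c [set x : C | x != 0].
Proof.
move=> c0; apply: open_nbhs_nbhs; split=> //.
rewrite (_ : [set x | x != 0] = ~` [set 0 : C]); last first.
  by apply/seteqP; split=> x /eqP.
apply: closed_openC; apply: accessible_closed_set1.
by apply: hausdorff_accessible; exact: norm_hausdorff.
Qed.

Lemma differentiable_invmx r (f : V -> 'M[C]_r) x :
  differentiable f x -> f x \in unitmx -> differentiable (fun y => invmx (f y)) x.
Proof.
move=> df; rewrite unitmxE unitfE => fx.
have dfE i j := differentiable_entry i j df.
have ddet := differentiable_det dfE.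
pose g y : 'M[C]_r := (\det (f y))^-1 *: \adj (f y).
apply: (@near_eq_differentiable _ _ _ g).
  have fn0 : nbhs x [set y | \det (f y) != 0].
    exact: (differentiable_continuous ddet (nbhs_neq0 fx)).
  by apply: filterS fn0 => y /= fy; rewrite /invmx unitmxE unitfE fy.
apply: (@differentiable_mx _ _ g) => i j; rewrite /g.
rewrite (_ : (fun _ => _) =
  (fun y => (\det (f y))^-1) * (fun y => (\adj (f y)) i j)); last first.
  by apply/funext => y; rewrite mxE.
apply: differentiableM; first exact: differentiableV.
rewrite (_ : (fun _ => _) = cst ((-1) ^+ (j + i)) *
    (fun y => \det (row' j (col' i (f y))))); last first.
  by apply/funext => y; rewrite mxE.
apply: differentiableM; first exact: differentiable_cst.
apply: differentiable_det => k l.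
rewrite (_ : (fun _ => _) = fun y => f y (lift j k) (lift i l)) //.
by apply/funext => y; rewrite !mxE.
Qed.

End MatrixDifferentials.

Section Jacobians.
Variables (C : numFieldType) (m n : nat).

Lemma mul_jacobian (u : 'rV[C]_m) (f : 'rV[C]_m -> 'rV[C]_n) z :
  u *m jacobian f z = 'd f z u.
Proof. by rewrite /jacobian mul_rV_lin1. Qed.

Lemma near_eq_jacobian (f g : 'rV[C]_m -> 'rV[C]_n) z :
  (\forall y \near z, f y = g y) -> differentiable f z ->
  jacobian g z = jacobian f z.
Proof.
move=> fg df; have [_ dE] := near_eq_diff fg df.
apply/row_matrixP => a; rewrite [LHS]rowE [RHS]rowE.
apply: etrans (mul_jacobian _ g z) _.
apply: etrans _ (esym (mul_jacobian _ f z)).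
exact: (congr1 (fun h => h _) dE).
Qed.

End Jacobians.

Lemma jacobian_id (C : numFieldType) (m : nat) (z : 'rV[C]_m) : jacobian (@id 'rV[C]_m) z = 1%:M.
Proof.
have [_ dE] := is_diff_id z.
apply/row_matrixP => a; rewrite [LHS]rowE [RHS]rowE.
apply: etrans (mul_jacobian _ (@id 'rV[C]_m) z) _; rewrite mulmx1.
exact: (congr1 (fun h => h _) dE).
Qed.

Lemma jacobian_comp (C : numFieldType) (m n l : nat)
    (f : 'rV[C]_m -> 'rV[C]_n) (g : 'rV[C]_n -> 'rV[C]_l) z :
  differentiable f z -> differentiable g (f z) ->
  jacobian (g \o f) z = jacobian f z *m jacobian g (f z).
Proof.
move=> df dg; apply/row_matrixP => a; rewrite [LHS]rowE [RHS]rowE mulmxA.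
apply: etrans (mul_jacobian _ (g \o f) z) _.
apply: etrans _ (esym (mul_jacobian _ g (f z))).
apply: etrans _ (congr1 ('d g (f z)) (esym (mul_jacobian _ f z))).
exact: (congr1 (fun h => h _) (diff_comp df dg)).
Qed.

Section TangentBundle.
Variables (C : numFieldType) (n : nat) (M : holo_atlas C n).

Lemma chart_near (j k : chart_ix M) p : chart_dom j p -> chart_dom k p ->
  \forall z \near chart j p, (chart j @` (chart_dom j `&` chart_dom k)) z.
Proof.
by move=> jp kp; apply: open_nbhs_nbhs; split; [exact: chart_open|exists p].
Qed.

Lemma tangent_trans_id (i : chart_ix M) p : chart_dom i p ->
  tangent_trans i i p = 1%:M.
Proof.
move=> ip; have idE : \forall z \near chart i p, id z = (chart i \o param i) z.
  by apply: filterS (chart_near ip ip) => _ [q [iq _]] <- /=; rewrite chartK.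
have [did _] := is_diff_id (chart i p).
apply: etrans (congr1 trmx (near_eq_jacobian idE did)) _.
by rewrite jacobian_id trmx1.
Qed.

Lemma tangent_trans_mul (i j k : chart_ix M) p :
  chart_dom i p -> chart_dom j p -> chart_dom k p ->
  tangent_trans i j p *m tangent_trans j k p = tangent_trans i k p.
Proof.
move=> ip jp kp; rewrite /tangent_trans -trmx_mul; congr (_^T).
have djk : differentiable (chart j \o param k) (chart k p).
  by apply: chart_holo; exists p.
have jE : (chart j \o param k) (chart k p) = chart j p by rewrite /= chartK.
have dij : differentiable (chart i \o param j)
    ((chart j \o param k) (chart k p)).
  by rewrite jE; apply: chart_holo; exists p.
have ijkE : \forall z \near chart k p,
    ((chart i \o param j) \o (chart j \o param k)) z = (chart i \o param k) z.
  by apply: filterS (chart_near kp jp) => _ [q [kq jq]] <- /=; rewrite !chartK.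
apply: esym; apply: etrans (near_eq_jacobian ijkE (differentiable_comp djk dij)) _.
apply: etrans (jacobian_comp djk dij) _.
by rewrite jE.
Qed.

Lemma chart_dom_open (i : chart_ix M) : open_in (chart_dom i).
Proof. by move=> k; exact: chart_open. Qed.

(* Over the complex numbers the hypothesis always holds, by Cauchy's integral
   formula, which the library does not have. *)
Hypothesis tangent_trans_holo : forall i j : chart_ix M,
  holomorphic_on (chart_dom i `&` chart_dom j) (tangent_trans i j).

Definition tangent_cocycle : cocycle M n :=
  Cocycle chart_dom_open (@chart_cover C n M) tangent_trans_holo
    tangent_trans_id tangent_trans_mul.

Definition tangent_bundle : holo_bundle M n := glue_bundle tangent_cocycle.

End TangentBundle.

Section ProjectivePlane.
Variable C : numFieldType.

(* The points of the projective plane are the lines of C^3. *)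
Definition proj_plane : Type := {L : {vspace 'rV[C]_3} | \dim L == 1%N}.

(* Homogeneous coordinates of p, for some choice of a nonzero vector of the
   line; all that follows only involves their quotients. *)
Definition zeta (p : proj_plane) : 'rV[C]_3 := vpick (sval p).

Definition U (k : 'I_3) : set proj_plane := [set p | zeta p 0 k != 0].

(* w k i is the affine coordinate w_k^i. *)
Definition w (k i : 'I_3) (p : proj_plane) : C := zeta p 0 i / zeta p 0 k.

(* The coordinates w_k^i (i != k) on U_k, with i in increasing order. *)
Definition affine_chart (k : 'I_3) (p : proj_plane) : 'rV[C]_2 :=
  \row_l w k (lift k l) p.

Definition homog (k : 'I_3) (z : 'rV[C]_2) : 'rV[C]_3 :=
  \row_i oapp (z 0) 1 (unlift k i).

Lemma homogk k z : homog k z 0 k = 1.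
Proof. by rewrite mxE unlift_none. Qed.

Lemma homog_lift k z l : homog k z 0 (lift k l) = z 0 l.
Proof. by rewrite mxE liftK. Qed.

Lemma homog_neq0 k z : homog k z != 0.
Proof.
apply/eqP => /rowP /(_ k); rewrite homogk mxE => /eqP.
by rewrite oner_eq0.
Qed.

Lemma dim_homog k z : \dim <[homog k z]>%VS == 1%N.
Proof. by rewrite dim_vline homog_neq0. Qed.

Definition affine_param (k : 'I_3) (z : 'rV[C]_2) : proj_plane :=
  exist (fun L => is_true (\dim L == 1%N)) _ (dim_homog k z).

Lemma zeta_neq0 p : zeta p != 0.
Proof.
case: p => L dL; rewrite /zeta vpick0 -dimv_eq0 /=.
by rewrite (eqP dL).
Qed.

Lemma zetaE p : sval p = <[zeta p]>%VS.
Proof.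
case: p (zeta_neq0 p) => L dL; rewrite /zeta /= => nz.
apply/eqP; rewrite eq_sym eqEdim dim_vline nz (eqP dL) andbT.
by rewrite -memvE memv_pick.
Qed.

Lemma zeta_param k z : exists2 c, c != 0 & zeta (affine_param k z) = c *: homog k z.
Proof.
have : zeta (affine_param k z) \in <[homog k z]>%VS by exact: memv_pick.
move=> /vlineP[c cE]; exists c => //; apply/eqP => c0.
by move: (zeta_neq0 (affine_param k z)); rewrite cE c0 scale0r eqxx.
Qed.

Lemma w_param k z i j : w i j (affine_param k z) = homog k z 0 j / homog k z 0 i.
Proof.
have [c c0 cE] := zeta_param k z; rewrite /w cE !mxE invfM mulrACA divff//.
by rewrite mul1r.
Qed.

Lemma U_param k z i : U i (affine_param k z) <-> homog k z 0 i != 0.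
Proof.
have [c c0 cE] := zeta_param k z.
by rewrite /U /= cE mxE mulf_eq0 (negPf c0).
Qed.

Lemma homog_chart k p : U k p -> zeta p = zeta p 0 k *: homog k (affine_chart k p).
Proof.
move=> kp; apply/rowP => i; rewrite 2!mxE.
case: unliftP => [l ->|->] /=; last by rewrite mulr1.
by rewrite mxE /w mulrC mulfVK.
Qed.

Lemma affine_chartK k p : U k p -> affine_param k (affine_chart k p) = p.
Proof.
move=> kp; apply: val_inj => /=; rewrite [RHS]zetaE [in RHS](homog_chart kp).
apply/eqP; rewrite eqEdim !dim_vline homog_neq0 scaler_eq0 (negPf (homog_neq0 _ _)).
rewrite (negPf (kp : _ != 0)) /= leqnn andbT -memvE.
apply/vlineP; exists (zeta p 0 k)^-1.
by rewrite scalerA mulVf// scale1r.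
Qed.

Lemma affine_paramK k z : affine_chart k (affine_param k z) = z.
Proof. by apply/rowP => l; rewrite mxE w_param homogk divr1 homog_lift. Qed.

Lemma affine_image k (A : set proj_plane) :
  affine_chart k @` (U k `&` A) = affine_param k @^-1` A.
Proof.
apply/seteqP; split=> [_ [p [kp Ap] <-]|z Az] /=; first by rewrite affine_chartK.
exists (affine_param k z); last by rewrite affine_paramK.
by split=> //; apply/U_param; rewrite homogk oner_eq0.
Qed.

Lemma affine_preimageU k l :
  affine_param k @^-1` U l = [set z | homog k z 0 l != 0].
Proof. by apply/seteqP; split=> z /U_param. Qed.

Lemma differentiable_homog k i z :
  differentiable (fun z => homog k z 0 i : C) z.
Proof.
have [l ->|->] := unliftP k i.
  rewrite (_ : (fun _ => _) = fun y : 'rV_2 => y 0 l); last first.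
    by apply/funext => y; rewrite homog_lift.
  exact: differentiable_coord.
rewrite (_ : (fun _ => _) = cst 1); last by apply/funext => y; rewrite homogk.
exact: differentiable_cst.
Qed.

Lemma homog_open k l : open [set z | homog k z 0 l != 0].
Proof.
apply: (@open_comp _ _ (fun z => homog k z 0 l : C) [set x | x != 0]).
  by move=> z _; apply: differentiable_continuous; exact: differentiable_homog.
rewrite openE => x; exact: nbhs_neq0.
Qed.

Lemma proj_plane_cover p : exists k, U k p.
Proof.
apply/not_existsP => nU; move: (zeta_neq0 p); apply/negP; rewrite negbK.
apply/eqP/rowP => i; rewrite [RHS]mxE; apply/eqP/negPn/negP.
exact: nU.
Qed.

Lemma affine_open j k : open (affine_chart j @` (U j `&` U k)).
Proof. by rewrite affine_image affine_preimageU; exact: homog_open. Qed.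

Lemma affine_holo j k z : (affine_chart j @` (U j `&` U k)) z ->
  differentiable (affine_chart k \o affine_param j) z.
Proof.
rewrite affine_image affine_preimageU => /= nz.
apply: differentiable_mx => a b.
rewrite (_ : (fun _ => _) = fun y => homog j y 0 (lift k b) / homog j y 0 k).
  by apply: differentiable_div => //; exact: differentiable_homog.
by apply/funext => y /=; rewrite mxE w_param.
Qed.

Definition P2 : holo_atlas C 2 :=
  HoloAtlas proj_plane_cover affine_chartK affine_open affine_holo.

Lemma diff_homog k l (z v : 'rV[C]_2) :
  'd (fun z => homog k z 0 l : C) z v = homog k v 0 l - homog k 0 0 l.
Proof.
have [m ->|->] := unliftP k l.
  rewrite (_ : (fun _ => _) = fun y : 'rV_2 => y 0 m); last first.
    by apply/funext => y; rewrite homog_lift.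
  have [did dE] := is_diff_id z.
  by rewrite (diff_entry 0 m v did) dE !homog_lift mxE subr0.
rewrite (_ : (fun _ => _) = cst 1); last by apply/funext => y; rewrite homogk.
by rewrite diff_cst !homogk subrr.
Qed.

Lemma affine_jacobian i j (y : 'rV[C]_2) a b : homog j y 0 i != 0 ->
  jacobian (affine_chart i \o affine_param j) y b a =
  ((homog j (delta_mx 0 b) 0 (lift i a) - homog j 0 0 (lift i a)) * homog j y 0 i
   - homog j y 0 (lift i a) * (homog j (delta_mx 0 b) 0 i - homog j 0 0 i))
  / homog j y 0 i ^+ 2.
Proof.
move=> nz.
have dF : differentiable (affine_chart i \o affine_param j) y.
  by apply: affine_holo; rewrite affine_image affine_preimageU.
have -> : jacobian (affine_chart i \o affine_param j) y b a =
    'd (affine_chart i \o affine_param j) y (delta_mx 0 b) 0 a.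
  apply: etrans _ (congr1 (fun u : 'rV_2 => u 0 a) (mul_jacobian _ _ y)).
  by rewrite -rowE [RHS]mxE.
rewrite -(diff_entry 0 a _ dF).
rewrite (_ : (fun _ => _) = fun y => homog j y 0 (lift i a) / homog j y 0 i).
  by rewrite diff_div// ?diff_homog//; exact: differentiable_homog.
by apply/funext => x /=; rewrite mxE w_param.
Qed.

Lemma differentiable_w_param i j k z : homog k z 0 i != 0 ->
  differentiable (fun z => w i j (affine_param k z) : C) z.
Proof.
move=> nz.
rewrite (_ : (fun _ => _) = fun y => homog k y 0 j / homog k y 0 i); last first.
  by apply/funext => y; rewrite w_param.
by apply: differentiable_div => //; exact: differentiable_homog.
Qed.

Lemma P2_tangent_holo (i j : chart_ix P2) :
  holomorphic_on (chart_dom i `&` chart_dom j) (tangent_trans i j).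
Proof.
move=> k z kz.
have : (affine_param k @^-1` (U i `&` U j)) z by rewrite -affine_image.
case=> /U_param iz /U_param jz.
have near_ij : \forall y \near z, homog k y 0 i != 0 /\ homog k y 0 j != 0.
  by near=> y; split; near: y;
    apply: open_nbhs_nbhs; split => //; exact: homog_open.
pose h (l : 'I_3) (y : 'rV[C]_2) : C := homog j (affine_chart j (affine_param k y)) 0 l.
have hE l y : homog k y 0 j != 0 -> h l y = w j l (affine_param k y).
  move=> yj; have jy : U j (affine_param k y) by apply/U_param.
  by rewrite /h /w [in RHS](homog_chart jy) !mxE unlift_none /= mulr1 mulrC mulKf.
have dh l : differentiable (h l) z.
  apply: (@near_eq_differentiable _ _ _ (fun y => w j l (affine_param k y))).
    by apply: filterS near_ij => y [_ yj]; rewrite hE.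
  exact: differentiable_w_param.
have h0 y : homog k y 0 i != 0 /\ homog k y 0 j != 0 -> h i y != 0.
  by case=> yi yj; rewrite hE// w_param mulf_neq0// invr_neq0.
apply: differentiable_mx => a b.
pose D l : C := homog j (delta_mx 0 b) 0 l - homog j 0 0 l.
apply: (@near_eq_differentiable _ _ _ (fun y =>
   (D (lift i a) * h i y - h (lift i a) y * D i) / (h i y) ^+ 2)).
  apply: filterS near_ij => y /h0 hy.
  by rewrite /= /tangent_trans [RHS]mxE affine_jacobian.
apply: differentiable_div; last by rewrite expf_neq0// h0.
  apply: differentiableB.
    by apply: differentiableM => //; exact: differentiable_cst.
  by apply: differentiableM => //; exact: differentiable_cst.
exact: differentiableM.
Unshelve. all: by end_near. Qed.

Definition tangent_P2 : holo_bundle P2 2 := tangent_bundle P2_tangent_holo.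

End ProjectivePlane.

Section Mirror.
Variables (C : numFieldType) (a b : 'I_3 -> C).
Hypothesis a_neq0 : forall i, a i != 0.
Hypothesis b_neq0 : forall i, b i != 0.
Hypothesis prod_ab : \prod_(i < 3) (a i * b i) = -1.

Local Notation P2 := (P2 C).

Definition mx22 (x y z t : C) : 'M[C]_2 :=
  \matrix_(i, j) nth 0 (nth [::] [:: [:: x; y]; [:: z; t]] i) j.

Definition tau_sf10 (p : P2) := mx22 (a 0 / w 0 1 p ^+ 2) 0 0 (b 0 / w 0 1 p).
Definition tau_sf21 (p : P2) := mx22 (b 1 / w 1 2 p) 0 0 (a 1 / w 1 2 p ^+ 2).
Definition tau_sf02 (p : P2) := mx22 0 (b 2 / w 2 0 p) (a 2 / w 2 0 p ^+ 2) 0.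

Definition Theta10 (p : P2) :=
  mx22 1 0 (- (a 0 * b 1 * a 2 * (w 0 2 p / w 0 1 p))) 1.
Definition Theta21 (p : P2) :=
  mx22 1 (- (a 0 * a 1 * b 2 * (w 1 0 p / w 1 2 p))) 0 1.
Definition Theta02 (p : P2) :=
  mx22 1 0 (- (b 0 * a 1 * a 2 * (w 2 1 p / w 2 0 p))) 1.

Definition tau10 (p : P2) := tau_sf10 p *m Theta10 p.
Definition tau21 (p : P2) := tau_sf21 p *m Theta21 p.
Definition tau02 (p : P2) := tau_sf02 p *m Theta02 p.

(* The transition functions of the instanton-corrected mirror, in the frames
   (-,+), (+,-), (-,+) of E_0, E_1, E_2; tau_ji is the inverse of tau_ij. *)
Definition mirror_trans (i j : 'I_3) (p : P2) : 'M[C]_2 :=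
  match val i, val j with
  | 1%N, 0%N => tau10 p
  | 2%N, 1%N => tau21 p
  | 0%N, 2%N => tau02 p
  | 0%N, 1%N => invmx (tau10 p)
  | 1%N, 2%N => invmx (tau21 p)
  | 2%N, 0%N => invmx (tau02 p)
  | _, _ => 1%:M
  end.

Lemma mx22E x y z t (i j : 'I_2) : mx22 x y z t i j =
  if i == 0 then (if j == 0 then x else y) else (if j == 0 then z else t).
Proof. by rewrite mxE; case: i => -[|[]]//= _; case: j => -[|[]]//= _. Qed.

Lemma mx22_eq (A B : 'M[C]_2) : A 0 0 = B 0 0 -> A 0 1 = B 0 1 ->
  A 1 0 = B 1 0 -> A 1 1 = B 1 1 -> A = B.
Proof.
move=> h1 h2 h3 h4; apply/matrixP => i j.
have E (k : 'I_2) : k = 0 \/ k = 1.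
  by case: k => -[|[]]// k; [left|right]; apply: val_inj.
by case: (E i) => ->; case: (E j) => ->.
Qed.

Lemma mul_mx22 x y z t x' y' z' t' :
  mx22 x y z t *m mx22 x' y' z' t' =
  mx22 (x * x' + y * z') (x * y' + y * t') (z * x' + t * z') (z * y' + t * t').
Proof.
by apply: mx22_eq; rewrite mxE !big_ord_recl big_ord0 addr0 !mx22E.
Qed.

Lemma det_mx22 x y z t : \det (mx22 x y z t) = x * t - y * z.
Proof.
rewrite (expand_det_row _ 0) !big_ord_recl big_ord0 /cofactor !det_mx11.
rewrite !mxE /=; ring.
Qed.

Lemma mx22_1 : mx22 1 0 0 1 = 1%:M.
Proof. by apply: mx22_eq; rewrite mx22E mxE. Qed.

Lemma w_neq0 i j p : U i p -> U j p -> w i j p != 0 :> C.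
Proof. by move=> ip jp; rewrite mulf_neq0// invr_neq0. Qed.

Lemma tau10_unit p : U 0 p -> U 1 p -> tau10 p \in unitmx.
Proof.
move=> p0 p1; have w0 := w_neq0 p0 p1.
rewrite unitmxE unitfE /tau10 det_mulmx !det_mx22.
rewrite [X in X != 0](_ : _ = a 0 * b 0 / w 0 1 p ^+ 3); last by field.
by rewrite !mulf_neq0 ?invr_neq0 ?expf_neq0.
Qed.

Lemma tau21_unit p : U 1 p -> U 2 p -> tau21 p \in unitmx.
Proof.
move=> p1 p2; have w0 := w_neq0 p1 p2.
rewrite unitmxE unitfE /tau21 det_mulmx !det_mx22.
rewrite [X in X != 0](_ : _ = a 1 * b 1 / w 1 2 p ^+ 3); last by field.
by rewrite !mulf_neq0 ?invr_neq0 ?expf_neq0.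
Qed.

Lemma tau02_unit p : U 2 p -> U 0 p -> tau02 p \in unitmx.
Proof.
move=> p2 p0; have w0 := w_neq0 p2 p0.
rewrite unitmxE unitfE /tau02 det_mulmx !det_mx22.
rewrite [X in X != 0](_ : _ = - (a 2 * b 2 / w 2 0 p ^+ 3)); last by field.
by rewrite oppr_eq0 !mulf_neq0 ?invr_neq0 ?expf_neq0.
Qed.

Lemma tau_cocycle p : U 0 p -> U 1 p -> U 2 p ->
  tau02 p *m (tau21 p *m tau10 p) = 1%:M.
Proof.
rewrite /U /= => p0 p1 p2; rewrite /tau02 /tau21 /tau10 !mul_mx22 -mx22_1.
have b2E : b 2 = - (a 0 * b 0 * a 1 * b 1 * a 2)^-1.
  have := prod_ab; rewrite !big_ord_recl big_ord0 mulr1.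
  rewrite (_ : lift ord0 ord0 = 1 :> 'I_3); last exact: val_inj.
  rewrite (_ : lift ord0 (lift ord0 ord0) = 2 :> 'I_3); last exact: val_inj.
  move=> abE; apply: (@mulfI _ (a 0 * b 0 * a 1 * b 1 * a 2)).
    by rewrite !mulf_neq0.
  rewrite mulrN divff ?mulf_neq0// -abE; ring.
move: (a_neq0 0) (a_neq0 1) (a_neq0 2) (b_neq0 0) (b_neq0 1) => a0 a1 a2 b0 b1.
by congr mx22; rewrite /w b2E; field; rewrite ?p0 ?p1 ?p2 ?a0 ?a1 ?a2 ?b0 ?b1.
Qed.

Lemma mirror_trans_id i p : mirror_trans i i p = 1%:M.
Proof. by rewrite /mirror_trans; case: i => -[|[|[]]]. Qed.

Lemma invmx_unique m (A B : 'M[C]_m) : A *m B = 1%:M -> invmx A = B.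
Proof.
by move=> AB; have [uA _] := mulmx1_unit AB; rewrite -[B](mulKmx uA) AB mulmx1.
Qed.

Lemma mirror_trans_mul i j k p : U i p -> U j p -> U k p ->
  mirror_trans i j p *m mirror_trans j k p = mirror_trans i k p.
Proof.
have ordE (i0 : 'I_3) : [\/ i0 = 0, i0 = 1 | i0 = 2].
  by case: i0 => -[|[|[]]]// ?; [apply: Or31|apply: Or32|apply: Or33]; exact: val_inj.
have [<-|ij] := eqVneq i j; first by rewrite mirror_trans_id mul1mx.
have [<-|jk] := eqVneq j k; first by rewrite mirror_trans_id mulmx1.
have [ki|ik] := eqVneq i k.
  subst k => ip jp _; rewrite mirror_trans_id.
  move: ij {jk}; case: (ordE i) ip => -> ip; case: (ordE j) jp => -> jp //= _;
    rewrite /mirror_trans /=; (apply: mulVmx || apply: mulmxV);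
    by (apply: tau10_unit || apply: tau21_unit || apply: tau02_unit).
move=> ip jp kp.
have [p0 p1 p2] : [/\ U 0 p, U 1 p & U 2 p].
  by move: ip jp kp ij jk ik; case: (ordE i) => ->; case: (ordE j) => ->;
    case: (ordE k) => ->.
have X := tau10_unit p0 p1; have Y := tau21_unit p1 p2; have Z := tau02_unit p2 p0.
have ZYX := tau_cocycle p0 p1 p2.
have XZY : tau10 p *m (tau02 p *m tau21 p) = 1%:M.
  by apply: mulmx1C; rewrite -mulmxA.
have YXZ : tau21 p *m (tau10 p *m tau02 p) = 1%:M.
  by apply: mulmx1C; rewrite -mulmxA.
have eZ := invmx_unique ZYX; have eX := invmx_unique XZY.
have eY := invmx_unique YXZ.
move: ij jk ik; case: (ordE i) => ->; case: (ordE j) => ->;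
  case: (ordE k) => -> //= _ _ _; rewrite /mirror_trans /=.
- by rewrite eX eY -mulmxA YXZ mulmx1.
- by rewrite eY eZ -mulmxA ZYX mulmx1.
- by rewrite eZ eX -mulmxA XZY mulmx1.
Qed.

Section Holomorphy.
Variables (k : 'I_3) (z : 'rV[C]_2).
Let par := affine_param k : 'rV[C]_2 -> P2.

Lemma differentiable_mx22 (f g h l : P2 -> C) :
  differentiable (f \o par) z -> differentiable (g \o par) z ->
  differentiable (h \o par) z -> differentiable (l \o par) z ->
  differentiable ((fun p => mx22 (f p) (g p) (h p) (l p)) \o par) z.
Proof.
move=> df dg dh dl; apply: differentiable_mx => i j.
pose t : P2 -> C := if i == 0 then (if j == 0 then f else g)
  else (if j == 0 then h else l).
rewrite (_ : (fun _ => _) = t \o par); last first.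
  by apply/funext => y; rewrite /= mx22E /t /=; case: ifP; case: ifP.
by rewrite /t; case: ifP; case: ifP.
Qed.

Lemma differentiable_divw (c : C) i j n : U i (par z) -> U j (par z) ->
  differentiable ((fun p => c / w i j p ^+ n.+1) \o par) z.
Proof.
move=> iz jz; have w0 := w_neq0 iz jz.
have dw : differentiable (fun y => w i j (par y) : C) z.
  by apply: differentiable_w_param; apply/U_param.
apply: (@differentiable_div _ _ (cst c) (fun y => w i j (par y) ^+ n.+1)).
- exact: differentiable_cst.
- by have := differentiableX n dw; rewrite exprfctE.
- by rewrite expf_neq0.
Qed.

Lemma differentiable_theta (c : C) i j l : U i (par z) -> U j (par z) ->
  differentiable ((fun p => - (c * (w i l p / w i j p))) \o par) z.
Proof.
move=> iz jz; have w0 := w_neq0 iz jz; move/U_param: (iz) => hi.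
have dw m : differentiable (fun y => w i m (par y) : C) z.
  exact: differentiable_w_param.
apply: (@differentiableN _ _ _ (fun y => c * (w i l (par y) / w i j (par y)))).
apply: (@differentiableM _ _ (cst c) (fun y => w i l (par y) / w i j (par y))).
  exact: differentiable_cst.
exact: differentiable_div.
Qed.

Lemma tau10_holo : U 0 (par z) -> U 1 (par z) -> differentiable (tau10 \o par) z.
Proof.
move=> z0 z1.
apply: (@differentiable_mulmx _ _ _ _ _ (tau_sf10 \o par) (Theta10 \o par));
  rewrite /tau_sf10 /Theta10; apply: differentiable_mx22;
  solve [exact: differentiable_cst | exact: (differentiable_divw _ 1) |
    exact: (differentiable_divw _ 0) | exact: differentiable_theta].
Qed.

Lemma tau21_holo : U 1 (par z) -> U 2 (par z) -> differentiable (tau21 \o par) z.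
Proof.
move=> z1 z2.
apply: (@differentiable_mulmx _ _ _ _ _ (tau_sf21 \o par) (Theta21 \o par));
  rewrite /tau_sf21 /Theta21; apply: differentiable_mx22;
  solve [exact: differentiable_cst | exact: (differentiable_divw _ 1) |
    exact: (differentiable_divw _ 0) | exact: differentiable_theta].
Qed.

Lemma tau02_holo : U 2 (par z) -> U 0 (par z) -> differentiable (tau02 \o par) z.
Proof.
move=> z2 z0.
apply: (@differentiable_mulmx _ _ _ _ _ (tau_sf02 \o par) (Theta02 \o par));
  rewrite /tau_sf02 /Theta02; apply: differentiable_mx22;
  solve [exact: differentiable_cst | exact: (differentiable_divw _ 1) |
    exact: (differentiable_divw _ 0) | exact: differentiable_theta].
Qed.

End Holomorphy.

Lemma mirror_trans_holo (i j : 'I_3) :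
  @holomorphic_on _ _ P2 2 2 (@U C i `&` @U C j) (mirror_trans i j).
Proof.
move=> k z kz.
have : (affine_param k @^-1` (U i `&` U j)) z by rewrite -affine_image.
have dV (f : P2 -> 'M[C]_2) : differentiable (f \o affine_param k) z ->
    f (affine_param k z) \in unitmx ->
    differentiable ((fun p => invmx (f p)) \o affine_param k) z.
  exact: (@differentiable_invmx _ _ _ (f \o affine_param k)).
have d1 : differentiable ((fun=> 1%:M : 'M[C]_2) \o affine_param k) z.
  exact: differentiable_cst.
have ordE (i0 : 'I_3) : [\/ i0 = 0, i0 = 1 | i0 = 2].
  by case: i0 => -[|[|[]]]// ?; [apply: Or31|apply: Or32|apply: Or33]; exact: val_inj.
case: (ordE i) => ->; case: (ordE j) => -> [iz jz]; rewrite /mirror_trans /=;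
  solve [exact: d1 | exact: tau10_holo | exact: tau21_holo | exact: tau02_holo |
    apply: dV; [exact: tau10_holo|exact: tau10_unit] |
    apply: dV; [exact: tau21_holo|exact: tau21_unit] |
    apply: dV; [exact: tau02_holo|exact: tau02_unit]].
Qed.

Definition mirror_cocycle : cocycle P2 2 :=
  @Cocycle _ _ P2 2 'I_3 (@U C) mirror_trans
    (@chart_dom_open _ _ P2) (@proj_plane_cover C) mirror_trans_holo
    (fun i p _ => mirror_trans_id i p) mirror_trans_mul.

Definition mirror_bundle : holo_bundle P2 2 := glue_bundle mirror_cocycle.

End Mirror.

(* Main.v *)
Require Import Defs.
From mathcomp Require Import all_boot all_order all_algebra complex.
From mathcomp Require Import all_classical all_reals all_analysis.
From mathcomp Require Import ring.

Set Implicit Arguments.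
Unset Strict Implicit.
Unset Printing Implicit Defensive.

Import Order.TTheory GRing.Theory Num.Theory.
Local Open Scope ring_scope.

(** The two bundles are glued over the same cover, so an isomorphism amounts to
    invertible holomorphic [f_k] on [U_k] with [J_ij f_j = f_i tau'_ij], where
    [J_ij] is the Jacobian of the change of affine coordinates. Comparing the
    entries of these matrices, constant diagonal [f_k] suffice: up to a common
    factor the equations for (1,0) and (2,1) determine them, and the one for
    (0,2) then holds because the product of the [a_i b_i] is -1. *)

(** * Morphisms of glued bundles from local matrices *)

Section GluedMorphisms.
Variables (C : numFieldType) (n : nat) (M : holo_atlas C n).

Lemma holomorphic_on_mulmxr r s t (U : set M) (f : M -> 'M[C]_(r, s))
    (B : 'M[C]_(s, t)) :
  holomorphic_on U f -> holomorphic_on U (fun p => f p *m B).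
Proof.
move=> df k z kz.
apply: (@differentiable_mulmx _ _ _ _ _ (f \o param k) (cst B)).
  exact: df.
exact: differentiable_cst.
Qed.

Section Morphism.
Variables (r s : nat) (c : cocycle M r) (d : cocycle M s).
(** A bundle map in local form: [h k i] sends the [i]-th coordinates of the source to the [k]-th
    ones of the target. The covers of [c] and [d] may differ, so both indices are kept. *)
Variable h : cov_ix d -> cov_ix c -> M -> 'M[C]_(s, r).
Hypothesis h_src : forall k i j p, cov_dom k p -> cov_dom i p -> cov_dom j p ->
  h k i p *m trans_fun i j p = h k j p.
Hypothesis h_tgt : forall l k i p, cov_dom l p -> cov_dom k p -> cov_dom i p ->
  trans_fun l k p *m h k i p = h l i p.

(** An arbitrary choice of a trivialization around [p]; [coordE] shows by [h_src] that the resulting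
    map does not depend on it. *)
Let ix p : cov_ix c := projT1 (cid (cov_cover c p)).
Let ixP p : cov_dom (ix p) p := projT2 (cid (cov_cover c p)).

Let coord (e : glued c) (k : cov_ix d) : 'cV[C]_s :=
  if pselect (cov_dom k (glued_base e))
  then h k (ix (glued_base e)) (glued_base e) *m glued_coord e (ix (glued_base e))
  else 0.

Let coordE (e : glued c) k i : cov_dom k (glued_base e) -> cov_dom i (glued_base e) ->
  coord e k = h k i (glued_base e) *m glued_coord e i.
Proof.
move=> kp ip; rewrite /coord; case: pselect => //= _.
by rewrite [glued_coord e i](@glued_compat _ _ _ _ _ _ i (ix (glued_base e)))//
  mulmxA h_src.
Qed.

Let coord_out (e : glued c) k : ~ cov_dom k (glued_base e) -> coord e k = 0.
Proof. by move=> nk; rewrite /coord; case: pselect. Qed.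

Let coord_compat (e : glued c) k l : cov_dom k (glued_base e) -> cov_dom l (glued_base e) ->
  coord e k = trans_fun k l (glued_base e) *m coord e l.
Proof.
move=> kp lp.
by rewrite !(@coordE _ _ (ix (glued_base e)))// mulmxA h_tgt.
Qed.

Definition glued_map (e : glued c) : glued d :=
  Glued (@coord_out e) (@coord_compat e).

Lemma glued_map_coord (e : glued c) k i :
  cov_dom k (glued_base e) -> cov_dom i (glued_base e) ->
  glued_coord (glued_map e) k = h k i (glued_base e) *m glued_coord e i.
Proof. exact: coordE. Qed.

Lemma glued_map_morphism :
  (forall i k, holomorphic_on (cov_dom i `&` cov_dom k) (h k i)) ->
  bundle_morphism (E := glue_bundle c) (F := glue_bundle d) glued_map.
Proof.
move=> hh; split=> // i k; exists (h k i); split; first exact: hh.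
by move=> e [ie ke]; exact: glued_map_coord.
Qed.

End Morphism.

Lemma glued_mapK r s (c : cocycle M r) (d : cocycle M s) h h'
    (hs : forall k i j p, cov_dom k p -> cov_dom i p -> cov_dom j p ->
       h k i p *m trans_fun i j p = h k j p)
    (ht : forall l k i p, cov_dom l p -> cov_dom k p -> cov_dom i p ->
       trans_fun l k p *m h k i p = h l i p)
    (hs' : forall k i j p, cov_dom k p -> cov_dom i p -> cov_dom j p ->
       h' k i p *m trans_fun i j p = h' k j p)
    (ht' : forall l k i p, cov_dom l p -> cov_dom k p -> cov_dom i p ->
       trans_fun l k p *m h' k i p = h' l i p) :
  (forall i k p, cov_dom i p -> cov_dom k p -> h' i k p *m h k i p = 1%:M) ->
  cancel (glued_map (c := c) (d := d) hs ht) (glued_map (c := d) (d := c) hs' ht').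
Proof.
move=> hK e; apply: glued_eq => //; apply/funext => i.
(* Off the [i]-th open set both coordinates have the default value 0. On it, the composite is
   computed through any target trivialization around the base point. *)
have [ie|nie] := pselect (cov_dom i (glued_base e)); last by rewrite !glued_out.
have [k ke] := cov_cover d (glued_base e).
rewrite (@glued_map_coord _ _ _ _ _ hs' ht' (glued_map hs ht e) i k)//.
by rewrite (@glued_map_coord _ _ _ _ _ hs ht e k i)// mulmxA hK// mul1mx.
Qed.

(** Constant frame changes [f i] that conjugate one cocycle into the other give mutually inverse
    maps, and multiplying by a constant matrix preserves holomorphy. *)
Lemma glue_bundle_isomorphic r (I : Type) (D : I -> set M)
    (g g' : I -> I -> M -> 'M[C]_r) (f : I -> 'M[C]_r)
    (Do Do' : forall i, open_in (D i)) (Dc Dc' : forall p, exists i, D i p)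
    (gh : forall i j, holomorphic_on (D i `&` D j) (g i j))
    (gh' : forall i j, holomorphic_on (D i `&` D j) (g' i j))
    (g1 : forall i p, D i p -> g i i p = 1%:M)
    (g1' : forall i p, D i p -> g' i i p = 1%:M)
    (gM : forall i j k p, D i p -> D j p -> D k p ->
       g i j p *m g j k p = g i k p)
    (gM' : forall i j k p, D i p -> D j p -> D k p ->
       g' i j p *m g' j k p = g' i k p) :
  (forall i, f i \in unitmx) ->
  (forall i j p, D i p -> D j p -> g' i j p *m f j = f i *m g i j p) ->
  bundle_isomorphic (glue_bundle (Cocycle Do Dc gh g1 gM))
    (glue_bundle (Cocycle Do' Dc' gh' g1' gM')).
Proof.
move=> fU fE.
have fVE i j p : D i p -> D j p ->
    g i j p *m invmx (f j) = invmx (f i) *m g' i j p.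
  move=> ip jp; apply: (can_inj (mulKmx (fU i))).
  by rewrite mulmxA -fE// mulmxK// mulKVmx.
(* Change frame within the [i]-th trivialization, then pass to the [k]-th one of the target; [h']
   does the same with the inverse frame changes. *)
pose h k i p := g' k i p *m f i; pose h' i k p := g i k p *m invmx (f k).
set c := Cocycle Do _ _ _ _; set d := Cocycle Do' _ _ _ _.
have hs k i j p : D k p -> D i p -> D j p -> h k i p *m g i j p = h k j p.
  by move=> kp ip jp; rewrite /h -mulmxA -fE// mulmxA gM'.
have ht l k i p : D l p -> D k p -> D i p -> g' l k p *m h k i p = h l i p.
  by move=> lp kp ip; rewrite /h mulmxA gM'.
have hs' k i j p : D k p -> D i p -> D j p -> h' k i p *m g' i j p = h' k j p.
  by move=> kp ip jp; rewrite /h' -mulmxA -fVE// mulmxA gM.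
have ht' l k i p : D l p -> D k p -> D i p -> g l k p *m h' k i p = h' l i p.
  by move=> lp kp ip; rewrite /h' mulmxA gM.
exists (@glued_map _ _ c d h hs ht), (@glued_map _ _ d c h' hs' ht'); split.
- apply: glued_map_morphism => i k; apply: holomorphic_on_mulmxr.
  by rewrite setIC; exact: gh'.
- apply: glued_map_morphism => i k; apply: holomorphic_on_mulmxr.
  by rewrite setIC; exact: gh.
- apply: glued_mapK => i k p ip kp.
  by rewrite /h' /h fVE// -mulmxA (mulmxA (g' i k p)) gM'// g1'// mul1mx mulVmx.
- apply: glued_mapK => i k p ip kp.
  by rewrite /h' /h fE// -mulmxA (mulmxA (g i k p)) gM// g1// mul1mx mulmxV.
Qed.

End GluedMorphisms.

(** * Explicit Jacobians of the affine coordinate changes on the projective plane *)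

Section ProjectivePlaneTangent.
Variable C : numFieldType.

Lemma homog_w (k l : 'I_3) (p : P2 C) :
  U k p -> homog k (affine_chart k p) 0 l = w k l p.
Proof.
by move=> kp; rewrite /w [in RHS](homog_chart kp) !mxE unlift_none /= mulr1 mulrC mulKf.
Qed.

(** [homog k] is affine, so this difference is its derivative along the [m]-th basis vector; it
    vanishes for [l = k], where the coordinate is constantly 1. *)
Lemma homog_deltaB (k l : 'I_3) (m : 'I_2) :
  homog k (delta_mx 0 m) 0 l - homog k 0 0 l = (l == lift k m)%:R :> C.
Proof.
have [q ->|->] := unliftP k l.
  by rewrite !homog_lift !mxE subr0 /= (inj_eq lift_inj).
by rewrite !homogk subrr (negPf (neq_lift _ _)).
Qed.

(** The quotient rule for $w_i^m = w_j^m / w_j^i$ with [m = lift i k], differentiated in the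
    direction of $w_j^{m'}$ with [m' = lift j l]. *)
Lemma tangent_trans_P2E (i j : 'I_3) (p : P2 C) (k l : 'I_2) : U i p -> U j p ->
  tangent_trans (M := P2 C) i j p k l =
  ((lift i k == lift j l)%:R * w j i p - w j (lift i k) p * (i == lift j l)%:R)
  / w j i p ^+ 2.
Proof.
move=> ip jp; have wji : homog j (affine_chart j p) 0 i != 0.
  by rewrite homog_w// w_neq0.
by rewrite /tangent_trans [LHS]mxE /= affine_jacobian// !homog_deltaB !homog_w.
Qed.

Let lift3 : ((lift 0 0 = 1 :> 'I_3) * (lift 0 1 = 2 :> 'I_3) *
  (lift 1 0 = 0 :> 'I_3) * (lift 1 1 = 2 :> 'I_3) *
  (lift 2 0 = 0 :> 'I_3) * (lift 2 1 = 1 :> 'I_3))%type.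
Proof. by do ![split]; apply: val_inj. Qed.

Lemma tangent_trans10 (p : P2 C) : U 1 p -> U 0 p ->
  tangent_trans (M := P2 C) 1 0 p =
  mx22 (- (w 0 1 p ^+ 2)^-1) 0 (- (w 0 2 p / w 0 1 p ^+ 2)) (w 0 1 p)^-1.
Proof.
rewrite /U /= => p1 p0; apply: mx22_eq; rewrite tangent_trans_P2E// mx22E /=;
  by rewrite !lift3 /w /=; field; rewrite p1 p0.
Qed.

Lemma tangent_trans21 (p : P2 C) : U 2 p -> U 1 p ->
  tangent_trans (M := P2 C) 2 1 p =
  mx22 (w 1 2 p)^-1 (- (w 1 0 p / w 1 2 p ^+ 2)) 0 (- (w 1 2 p ^+ 2)^-1).
Proof.
rewrite /U /= => p2 p1; apply: mx22_eq; rewrite tangent_trans_P2E// mx22E /=;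
  by rewrite !lift3 /w /=; field; rewrite p2 p1.
Qed.

Lemma tangent_trans02 (p : P2 C) : U 0 p -> U 2 p ->
  tangent_trans (M := P2 C) 0 2 p =
  mx22 (- (w 2 1 p / w 2 0 p ^+ 2)) (w 2 0 p)^-1 (- (w 2 0 p ^+ 2)^-1) 0.
Proof.
rewrite /U /= => p0 p2; apply: mx22_eq; rewrite tangent_trans_P2E// mx22E /=;
  by rewrite !lift3 /w /=; field; rewrite p0 p2.
Qed.

End ProjectivePlaneTangent.

(** * Diagonal frame changes taking the mirror cocycle to the tangent cocycle *)

Section MirrorTangent.
Variables (C : numFieldType) (a b : 'I_3 -> C).
Hypothesis a_neq0 : forall i, a i != 0.
Hypothesis b_neq0 : forall i, b i != 0.
Hypothesis prod_ab : \prod_(i < 3) (a i * b i) = -1.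

(** Normalised by lower right entry 1 for [k = 1]. The equation for (1,0) then forces the rest of
    the matrices for 0 and 1, and the diagonal entries of the one for (2,1) force the matrix for
    2. *)
Definition frame_change (k : 'I_3) : 'M[C]_2 :=
  match val k with
  | 0%N => mx22 (a 0 * b 0 * b 1 * a 2) 0 0 (b 0)
  | 1%N => mx22 (- (b 0 * b 1 * a 2)) 0 0 1
  | _ => mx22 (- (b 0 * a 2)) 0 0 (- (a 1)^-1)
  end.

Lemma frame_change_unit k : frame_change k \in unitmx.
Proof.
case: k => -[|[|[]]]// ?; rewrite unitmxE unitfE /frame_change /= det_mx22 mulr0 subr0;
  by rewrite ?(mulf_neq0, oppr_eq0, invr_neq0, oner_eq0, a_neq0, b_neq0).
Qed.

Local Notation intertwine i j p :=
  (tangent_trans (M := P2 C) i j p *m frame_change j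
   = frame_change i *m mirror_trans a b i j p).

(** Solving the product condition for $b_2$ turns it into a substitution, after which only
    identities of rational functions remain. *)
Let b2E : b 2 = - (a 0 * b 0 * a 1 * b 1 * a 2)^-1.
Proof.
have := prod_ab; rewrite !big_ord_recl big_ord0 mulr1.
rewrite (_ : lift ord0 ord0 = 1 :> 'I_3); last exact: val_inj.
rewrite (_ : lift ord0 (lift ord0 ord0) = 2 :> 'I_3); last exact: val_inj.
move=> abE; apply: (@mulfI _ (a 0 * b 0 * a 1 * b 1 * a 2)).
  by rewrite !mulf_neq0.
rewrite mulrN divff ?mulf_neq0// -abE; ring.
Qed.

Lemma intertwine10 (p : P2 C) : U 1 p -> U 0 p -> intertwine 1 0 p.
Proof.
move=> p1 p0; have w0 := w_neq0 p0 p1.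
rewrite tangent_trans10// /frame_change /mirror_trans /= /tau10 !mul_mx22.
by congr mx22; field; rewrite ?w0 ?a_neq0 ?b_neq0.
Qed.

(** The upper right entry, which comes from [Theta21], is where the product condition enters. *)
Lemma intertwine21 (p : P2 C) : U 2 p -> U 1 p -> intertwine 2 1 p.
Proof.
move=> p2 p1; have w0 := w_neq0 p1 p2.
rewrite tangent_trans21// /frame_change /mirror_trans /= /tau21 !mul_mx22.
by congr mx22; rewrite ?b2E; field; rewrite ?w0 ?a_neq0 ?b_neq0.
Qed.

(** Here $b_2$ occurs in both entries of the first row, and each reduces to the product
    condition. *)
Lemma intertwine02 (p : P2 C) : U 0 p -> U 2 p -> intertwine 0 2 p.
Proof.
move=> p0 p2; have w0 := w_neq0 p2 p0.
rewrite tangent_trans02// /frame_change /mirror_trans /= /tau02 !mul_mx22.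
by congr mx22; rewrite ?b2E; field; rewrite ?w0 ?a_neq0 ?b_neq0.
Qed.

Let intertwine_sym i j (p : P2 C) : U i p -> U j p -> intertwine i j p -> intertwine j i p.
Proof.
move=> ip jp ijE.
have mK := mirror_trans_mul a_neq0 b_neq0 prod_ab ip jp ip.
have jK := tangent_trans_mul (M := P2 C) jp ip jp.
rewrite mirror_trans_id in mK; rewrite tangent_trans_id// in jK.
(* Insert $\tau'_{ij}\tau'_{ji} = I$ after $f_i$, so that the known relation applies and
   $J_{ji}J_{ij} = I$ cancels. *)
rewrite -[frame_change i]mulmx1 -mK !mulmxA -[_ *m _ *m mirror_trans a b i j p]mulmxA.
by rewrite -ijE !mulmxA jK mul1mx.
Qed.

Lemma frame_change_trans i j (p : P2 C) : U i p -> U j p -> intertwine i j p.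
Proof.
have ordE (i0 : 'I_3) : [\/ i0 = 0, i0 = 1 | i0 = 2].
  by case: i0 => -[|[|[]]]// ?; [apply: Or31|apply: Or32|apply: Or33]; exact: val_inj.
have [->|] := eqVneq i j.
  by rewrite mirror_trans_id mulmx1 => ? _; rewrite tangent_trans_id// mul1mx.
case: (ordE i) => ->; case: (ordE j) => -> // _ ip jp.
- by apply: intertwine_sym => //; apply: intertwine10.
- exact: intertwine02.
- exact: intertwine10.
- by apply: intertwine_sym => //; apply: intertwine21.
- by apply: intertwine_sym => //; apply: intertwine02.
- exact: intertwine21.
Qed.

Lemma mirror_isomorphic_tangent :
  bundle_isomorphic (mirror_bundle a_neq0 b_neq0 prod_ab) (tangent_P2 C).
Proof.
(* The chart domains of [P2] are the sets [U k], so both bundles unfold to gluings over this one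
   cover. *)
apply: (@glue_bundle_isomorphic C 2 (P2 C) 2 'I_3 (@U C) (mirror_trans a b)
  (@tangent_trans C 2 (P2 C)) frame_change); first exact: frame_change_unit.
exact: frame_change_trans.
Qed.

End MirrorTangent.

Theorem theorem1p2 (R : realType) (a b : 'I_3 -> R[i])
  (a_neq0 : forall i, a i != 0) (b_neq0 : forall i, b i != 0)
  (prod_ab : \prod_(i < 3) (a i * b i) = -1) :
  bundle_isomorphic (mirror_bundle a_neq0 b_neq0 prod_ab) (tangent_P2 R[i]).
Proof. exact: mirror_isomorphic_tangent. Qed.
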